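(* If the metric space $(X,d)$ is Ptolemaic and $2$-round, then $C_0(X,d)\leq\sqrt{2}$.
   Context: For a metric space $(X,d)$ and $\mu \geq 0$, say that $(X,d)$ satisfies the $(\mu,0)$-four-point inequality if for all $x,y,z,w\in X$, $d(x,y)+d(z,w)\le \mu\max\{d(x,z)+d(y,w),\ d(x,w)+d(y,z)\}$. The quadrilateral constant of $(X,d)$ is $C_0(X,d)=\inf\{\mu\geq 0 \mid (X,d)\text{ satisfies the }(\mu,0)\text{-four-point inequality}\}$. $(X,d)$ is Ptolemaic if for all $x,y,z,w\in X$, $d(x,y)d(z,w)\leq d(x,z)d(y,w)+d(x,w)d(y,z)$. $(X,d)$ is $2$-round if for all $x,y,z,w\in X$, $d(x,y)^2+d(z,w)^2\leq d(x,z)^2+d(y,w)^2+d(x,w)^2+d(y,z)^2$. *)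

(* Defs.v *)
From HB Require Import structures.
From mathcomp Require Import all_boot all_order all_algebra.
From mathcomp Require Import all_classical all_reals all_analysis.
From mathcomp Require Import lra.
Set Implicit Arguments. Unset Strict Implicit. Unset Printing Implicit Defensive.
Import Order.TTheory GRing.Theory Num.Theory.
Local Open Scope classical_set_scope.
Local Open Scope ring_scope.

Definition four_point_ineq0 (R : realType) (X : metricType R) (mu : R) : Prop :=
  forall x y z w : X,
    mdist x y + mdist z w <=
      mu * Num.max (mdist x z + mdist y w) (mdist x w + mdist y z).

Definition quadrilateral_constant (R : realType) (X : metricType R) : R :=
  inf [set mu : R | 0 <= mu /\ four_point_ineq0 X mu].

(* [inf] is 0 on sets without an infimum; this is never the case here, as every
   metric space satisfies the (2, 0)-four-point inequality. *)
Lemma has_inf_quadrilateral (R : realType) (X : metricType R) :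
  has_inf [set mu : R | 0 <= mu /\ four_point_ineq0 X mu].
Proof.
split; last by exists 0 => mu [].
exists 2; split=> // x y z w.
set m := Num.max _ _.
have h1 : mdist x z + mdist y w <= m by rewrite le_max lexx.
have h2 : mdist x w + mdist y z <= m by rewrite le_max lexx orbT.
have t1 := metric_triangle x z y; have t2 := metric_triangle x w y.
have t3 := metric_triangle z x w; have t4 := metric_triangle z y w.
rewrite (metric_sym z x) in t3; rewrite (metric_sym z y) in t1 t4.
rewrite (metric_sym w y) in t2.
lra.
Qed.

Definition ptolemaic (R : realType) (X : metricType R) : Prop :=
  forall x y z w : X,
    mdist x y * mdist z w <= mdist x z * mdist y w + mdist x w * mdist y z.

Definition two_round (R : realType) (X : metricType R) : Prop :=
  forall x y z w : X,
    mdist x y ^+ 2 + mdist z w ^+ 2 <=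
      mdist x z ^+ 2 + mdist y w ^+ 2 + mdist x w ^+ 2 + mdist y z ^+ 2.

(* Main.v *)
Require Import Defs.
From mathcomp Require Import all_boot all_order all_algebra.
From mathcomp Require Import all_classical all_reals all_analysis.
From mathcomp Require Import lra.
Import Order.TTheory GRing.Theory Num.Theory.
Local Open Scope ring_scope.

(** View [x, y] and [z, w] as the diagonals of a quadrilateral. Expanding the
    square of the sum of the diagonals, 2-roundness bounds the two squares by
    the sum of the squared sides, and the Ptolemaic inequality bounds the cross
    term by twice the sum of the products of opposite sides. The two bounds
    recombine into perfect squares
      (d(x,y) + d(z,w))^2 <= (d(x,z) + d(y,w))^2 + (d(x,w) + d(y,z))^2,
    and the right-hand side is at most twice the square of the larger sum of
    opposite sides. Hence sqrt 2 itself satisfies the four-point inequality. *)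

Lemma sqr_sum_diagonals_le (R : realType) (X : metricType R) (x y z w : X) :
  ptolemaic X -> two_round X ->
  (mdist x y + mdist z w) ^+ 2 <=
    (mdist x z + mdist y w) ^+ 2 + (mdist x w + mdist y z) ^+ 2.
Proof.
move=> /(_ x y z w) ptol /(_ x y z w) round2.
rewrite !sqrrD; lra.
Qed.

Lemma le_sqrt2_max (R : rcfType) (s p q : R) :
  0 <= p -> 0 <= q -> s ^+ 2 <= p ^+ 2 + q ^+ 2 ->
  s <= Num.sqrt 2 * Num.max p q.
Proof.
move=> p0 q0 spq; set m := Num.max p q.
have pm : p <= m by rewrite le_max lexx.
have qm : q <= m by rewrite le_max lexx orbT.
have m0 : 0 <= m := le_trans p0 pm.
have pm2 : p ^+ 2 <= m ^+ 2 by rewrite lerXn2r.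
have qm2 : q ^+ 2 <= m ^+ 2 by rewrite lerXn2r.
have [s0|/ltW s0] := leP 0 s; last first.
  by rewrite (le_trans s0)// mulr_ge0// sqrtr_ge0.
rewrite -(ler_pXn2r (n := 2)) ?nnegrE ?mulr_ge0 ?sqrtr_ge0//.
rewrite exprMn sqr_sqrtr ?ler0n//; lra.
Qed.

Theorem theorem4p2 (R : realType) (X : metricType R)
  (hP : ptolemaic X) (h2 : two_round X) :
  quadrilateral_constant X <= Num.sqrt 2.
Proof.
apply: ge_inf; first by have [] := has_inf_quadrilateral X.
split; first exact: sqrtr_ge0.
move=> x y z w; apply: le_sqrt2_max; rewrite ?addr_ge0 ?mdist_ge0//.
exact: sqr_sum_diagonals_le.
Qed.
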